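(* Let $p$ be a prime and let $${\mathcal D\mathcal L}=(\mathbb Z/p[\![x]\!]\oplus\mathbb Z/p[\![x]\!])\rtimes(C\otimes\mathbb Z_p)$$ be the double lamplighter pro-$p$-group. Then the kernel of the comparison homomorphism $$\varphi: H_2^{\sf disc}({\mathcal D\mathcal L},\mathbb Z/p)\longrightarrow H_2^{\sf cont}({\mathcal D\mathcal L},\mathbb Z/p)$$ is uncountable.
   Context: $C=\langle t\rangle$ is infinite cyclic and $C\otimes\mathbb Z_p=\{t^\alpha:\alpha\in\mathbb Z_p\}$ is the group of $p$-adic integers written multiplicatively; it acts on each copy of $\mathbb Z/p[\![x]\!]$ by multiplication by $(1-x)^\alpha$ (the continuous extension of the action of $t$ by multiplication by $1-x$). ${\mathcal D\mathcal L}$ is the pro-$p$-completion of the double lamplighter group $(\mathbb Z/p[C]\oplus\mathbb Z/p[C])\rtimes C=\langle a,b,c\mid [b,b^{a^i}]=[c,c^{a^i}]=[b,c^{a^i}]=b^p=c^p=1,\ i\in\mathbb Z\rangle$. For a profinite group $G$, $H_2^{\sf disc}(G,\mathbb Z/p)$ is the homology of $G$ as a discrete group, $H_2^{\sf cont}(G,\mathbb Z/p)=\varprojlim_U H_2(G/U,\mathbb Z/p)$ over open normal subgroups $U$, and $\varphi$ is the inverse limit of the maps induced by the projections $G\to G/U$. *)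

(* Defs.v *)
From Stdlib Require Import ClassicalEpsilon.
From HB Require Import structures.
From mathcomp Require Import all_boot all_order all_algebra.
Set Implicit Arguments. Unset Strict Implicit. Unset Printing Implicit Defensive.
Import Order.TTheory GRing.Theory Num.Theory.
Local Open Scope ring_scope.

(* a n is the residue of alpha mod p^n (normalized), compatible in n. *)
Definition padic (p : nat) :=
  {a : nat -> nat | forall n, (a n %% p ^ n = a n)%N /\ (a n.+1 %% p ^ n = a n)%N}.

Lemma padic0_proof (p : nat) :
  forall n : nat, (0 %% p ^ n = 0)%N /\ (0 %% p ^ n = 0)%N.
Proof. by move=> n; rewrite mod0n. Qed.

Definition padic0 (p : nat) : padic p := exist _ (fun _ => 0%N) (@padic0_proof p).

Lemma padd_proof (p : nat) (a b : padic p) :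
  forall n, ((sval a n + sval b n) %% p ^ n %% p ^ n = (sval a n + sval b n) %% p ^ n)%N
         /\ ((sval a n.+1 + sval b n.+1) %% p ^ n.+1 %% p ^ n
              = (sval a n + sval b n) %% p ^ n)%N.
Proof.
move=> n; split; first by rewrite modn_mod.
rewrite modn_dvdm; last by rewrite expnS dvdn_mull.
rewrite -modnDm.
have [_ ->] := svalP a n; have [_ ->] := svalP b n.
done.
Qed.

Definition padd (p : nat) (a b : padic p) : padic p :=
  exist _ (fun n => (sval a n + sval b n) %% p ^ n)%N (padd_proof a b).

Definition pseries (p : nat) := nat -> 'F_p.

(* k-th coefficient of (1-x)^alpha : the continuous extension of
   n |-> (1-x)^n; the k-th coefficient of (1-x)^(a_m) is constant for m > k. *)
Definition unit_coef (p : nat) (a : padic p) (k : nat) : 'F_p :=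
  ((1 - 'X) ^+ (sval a k.+1) : {poly 'F_p})`_k.

Definition act (p : nat) (a : padic p) (f : pseries p) : pseries p :=
  fun k => \sum_(i < k.+1) unit_coef a i * f (k - i)%N.

Definition DL (p : nat) := (pseries p * pseries p * padic p)%type.

Definition DLmul (p : nat) (x y : DL p) : DL p :=
  ((fun k => x.1.1 k + act x.2 y.1.1 k),
   (fun k => x.1.2 k + act x.2 y.1.2 k),
   padd x.2 y.2).

Definition DLone (p : nat) : DL p := ((fun _ => 0), (fun _ => 0), padic0 p).

(* basic open neighbourhoods of 1 in the (profinite = product) topology *)
Definition DLnbhd (p : nat) (n : nat) (x : DL p) : Prop :=
  (forall i, (i < n)%N -> x.1.1 i = 0 /\ x.1.2 i = 0) /\ sval x.2 n = 0%N.

Definition is_subgroup (p : nat) (U : DL p -> Prop) : Prop :=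
  U (DLone p) /\ (forall x y, U x -> U y -> U (DLmul x y))
  /\ (forall x y, U y -> U (DLmul x y) -> U x).

(* z = g^-1 u g lies in U whenever u does *)
Definition is_normal (p : nat) (U : DL p -> Prop) : Prop :=
  forall g u z, U u -> DLmul g z = DLmul u g -> U z.

Definition is_open (p : nat) (U : DL p -> Prop) : Prop :=
  exists n, forall x, DLnbhd n x -> U x.

Definition open_normal_subgroup (p : nat) (U : DL p -> Prop) : Prop :=
  [/\ is_subgroup U, is_normal U & is_open U].

(* A chain is a formal finite Z/p-linear combination of keys. *)
Definition fsum (p : nat) (K : Type) := seq (K * 'F_p)%type.

Definition coef (p : nat) (K : Type) (c : fsum p K) (k : K) : 'F_p :=
  \sum_(x <- c) (if excluded_middle_informative (x.1 = k) then x.2 else 0).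

Definition chain_eq (p : nat) (K : Type) (c c' : fsum p K) : Prop :=
  forall k, coef c k = coef c' k.

Definition csub (p : nat) (K : Type) (c c' : fsum p K) : fsum p K :=
  c ++ [seq (x.1, - x.2) | x <- c'].

Definition push (p : nat) (K K' : Type) (f : K -> K') (c : fsum p K) : fsum p K' :=
  [seq (f x.1, x.2) | x <- c].

(* d[g|h] = [h] - [gh] + [g] *)
Definition d2 (p : nat) (T : Type) (mul : T -> T -> T) (c : fsum p (T * T)) : fsum p T :=
  flatten [seq [:: (x.1.2, x.2); (mul x.1.1 x.1.2, - x.2); (x.1.1, x.2)] | x <- c].

(* d[g|h|k] = [h|k] - [gh|k] + [g|hk] - [g|h] *)
Definition d3 (p : nat) (T : Type) (mul : T -> T -> T) (c : fsum p (T * T * T))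
  : fsum p (T * T) :=
  flatten [seq [:: ((x.1.1.2, x.1.2), x.2); ((mul x.1.1.1 x.1.1.2, x.1.2), - x.2);
                   ((x.1.1.1, mul x.1.1.2 x.1.2), x.2); ((x.1.1.1, x.1.1.2), - x.2)]
          | x <- c].

Definition is_cycle2 (p : nat) (T : Type) (mul : T -> T -> T) (z : fsum p (T * T)) : Prop :=
  chain_eq (d2 mul z) [::].

Definition is_boundary2 (p : nat) (T : Type) (mul : T -> T -> T) (b : fsum p (T * T)) : Prop :=
  exists w : fsum p (T * T * T), chain_eq b (d3 mul w).

Definition coset (p : nat) (U : DL p -> Prop) (g : DL p) : DL p -> Prop :=
  fun x => exists u, U u /\ x = DLmul g u.

Definition setmul (p : nat) (A B : DL p -> Prop) : DL p -> Prop :=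
  fun x => exists a b, A a /\ B b /\ x = DLmul a b.

(* the image of the 2-chain z in C_2(DL/U) is a boundary of C_*(DL/U);
   every 3-chain of DL/U is the image of a 3-chain of DL *)
Definition quot_trivial (p : nat) (U : DL p -> Prop) (z : fsum p (DL p * DL p)) : Prop :=
  exists w : fsum p (DL p * DL p * DL p),
    chain_eq (push (fun k => (coset U k.1, coset U k.2)) z)
             (d3 (@setmul p)
                 (push (fun k => (coset U k.1.1, coset U k.1.2, coset U k.2)) w)).

Definition in_ker_phi (p : nat) (z : fsum p (DL p * DL p)) : Prop :=
  is_cycle2 (@DLmul p) z /\
  forall U : DL p -> Prop, open_normal_subgroup U -> quot_trivial U z.

(* Main.v *)
Require Import Defs.
From HB Require Import structures.
From mathcomp Require Import all_boot all_order all_algebra.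
From mathcomp Require Import ring zify boolp.
From Stdlib Require Import ClassicalEpsilon.
Set Implicit Arguments. Unset Strict Implicit. Unset Printing Implicit Defensive.
Import GRing.Theory.
Local Open Scope ring_scope.

(** Write M = F_p[[x]] for each lamp group and t^a = (1-x)^a.  Commuting lamps m
in the first copy and n in the second give a torus class in H_2, which is
bilinear in (m, n) and invariant under the diagonal action of Z_p.  Let
f = Sum_k (t^(p^k) - 1), with mirror image f' = Sum_k (t^(-p^k) - 1), and consider
z_a = (t^a f, 1) - (1, t^-a f').  In a finite quotient both series become finite
sums of group elements, for which (t^c, 1) = (1, t^-c); so z_a is in ker phi.
In the discrete group only elements of the group ring F_p[Z_p] may be moved
across.  Viewing M as the F_p-valued measures on Z_p, f' is not a quotient of two
finitely supported measures, since it has infinitely many atoms.  Hence on any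
finitely generated F_p[Z_p]-submodule of M containing 1 and f' there is
an additive L with L(t^c y) = t^-c L(y), L(1) = 0 and L(f') <> 0, and the 2-cocycle
(g, h) |-> g_1 t^-g L(h_2) takes the value -t^a L(f') on z_a.  These values are
pairwise distinct, and Z_p is uncountable. *)

(** * The ring F_p[[x]] *)

Section SeriesRing.
Variable p : nat.
Implicit Types f g h : pseries p.

Definition sadd f g : pseries p := fun k => f k + g k.
Definition sopp f : pseries p := fun k => - f k.
Definition smul f g : pseries p := fun k => \sum_(i < k.+1) f i * g (k - i)%N.
Definition szero : pseries p := fun _ => 0.
Definition sconst (c : 'F_p) : pseries p := fun k => if k == 0%N then c else 0.

(* The coefficients below n of a series form a polynomial; the ring laws of series are read off those of polynomials. *)
Definition trunc n f : {poly 'F_p} := \poly_(i < n) f i.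

Lemma smul_trunc n f g k : (k < n)%N -> smul f g k = (trunc n f * trunc n g)`_k.
Proof.
move=> kn; rewrite coefM; apply: eq_bigr => i _.
by rewrite !coef_poly (leq_ltn_trans (leq_subr _ _) kn) (leq_ltn_trans (leq_ord i) kn).
Qed.

Lemma coefM_agree n (P P' Q Q' : {poly 'F_p}) k : (k < n)%N ->
  (forall i, (i < n)%N -> P`_i = P'`_i) -> (forall i, (i < n)%N -> Q`_i = Q'`_i) ->
  (P * Q)`_k = (P' * Q')`_k.
Proof.
move=> kn eP eQ; rewrite !coefM; apply: eq_bigr => i _.
by rewrite eP ?eQ //; apply: leq_ltn_trans kn; rewrite ?leq_subr ?leq_ord.
Qed.

Lemma coef_trunc n f i : (i < n)%N -> (trunc n f)`_i = f i.
Proof. by move=> lin; rewrite coef_poly lin. Qed.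

Lemma trunc_smul n f g i : (i < n)%N -> (trunc n (smul f g))`_i = (trunc n f * trunc n g)`_i.
Proof. by move=> lin; rewrite coef_trunc // (smul_trunc _ _ lin). Qed.

Lemma smulC : commutative smul.
Proof. by move=> f g; apply: funext => k; rewrite !(@smul_trunc k.+1) // mulrC. Qed.

Lemma smulA : associative smul.
Proof.
move=> f g h; apply: funext => k; rewrite !(@smul_trunc k.+1) //.
transitivity ((trunc k.+1 f * (trunc k.+1 g * trunc k.+1 h))`_k).
  by apply: (@coefM_agree k.+1) => // i ik; rewrite trunc_smul.
rewrite mulrA; symmetry.
by apply: (@coefM_agree k.+1) => // i ik; rewrite trunc_smul.
Qed.

Lemma smul1 : left_id (sconst 1) smul.
Proof.
move=> f; apply: funext => k; rewrite /smul big_ord_recl /= subn0 mul1r.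
by rewrite big1 ?addr0 // => i _; rewrite mul0r.
Qed.

Lemma smulDl : left_distributive smul sadd.
Proof.
move=> f g h; apply: funext => k; rewrite /smul /sadd -big_split /=.
by apply: eq_bigr => i _; rewrite mulrDl.
Qed.

Lemma saddA : associative sadd.
Proof. by move=> f g h; apply: funext => k; rewrite /sadd addrA. Qed.
Lemma saddC : commutative sadd.
Proof. by move=> f g; apply: funext => k; rewrite /sadd addrC. Qed.
Lemma sadd0 : left_id szero sadd.
Proof. by move=> f; apply: funext => k; rewrite /sadd add0r. Qed.
Lemma saddN : left_inverse szero sopp sadd.
Proof. by move=> f; apply: funext => k; rewrite /sadd /sopp addNr. Qed.

Lemma sconst1_neq0 : sconst 1 <> szero.
Proof. by move/(congr1 (fun f => f 0%N)) => /eqP; rewrite /= oner_eq0. Qed.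

End SeriesRing.

HB.instance Definition _ (p : nat) := gen_eqMixin (pseries p).
HB.instance Definition _ (p : nat) := gen_choiceMixin (pseries p).
HB.instance Definition _ (p : nat) :=
  GRing.isZmodule.Build (pseries p) (@saddA p) (@saddC p) (@sadd0 p) (@saddN p).
HB.instance Definition _ (p : nat) :=
  GRing.Zmodule_isComNzRing.Build (pseries p) (@smulA p) (@smulC p) (@smul1 p) (@smulDl p)
    (introN eqP (@sconst1_neq0 p)).

Section SeriesTheory.
Variable p : nat.
Implicit Types f g h : pseries p.

Lemma addsE f g k : (f + g) k = f k + g k. Proof. by []. Qed.
Lemma oppsE f k : (- f) k = - f k. Proof. by []. Qed.
Lemma mulsE f g k : (f * g) k = \sum_(i < k.+1) f i * g (k - i)%N. Proof. by []. Qed.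
Lemma ones k : (1 : pseries p) k = (k == 0%N)%:R. Proof. by rewrite /GRing.one /= /sconst; case: eqP. Qed.
Lemma zeros k : (0 : pseries p) k = 0. Proof. by []. Qed.

Lemma sums I (r : seq I) P (F : I -> pseries p) k :
  (\sum_(i <- r | P i) F i) k = \sum_(i <- r | P i) F i k.
Proof. by apply: (big_morph (fun f : pseries p => f k)). Qed.

Definition agree n f g := forall i, (i < n)%N -> f i = g i.

Lemma agreeM n f f' g g' : agree n f f' -> agree n g g' -> agree n (f * g) (f' * g').
Proof.
move=> ef eg k kn; rewrite !mulsE; apply: eq_bigr => i _.
by rewrite ef ?eg //; apply: leq_ltn_trans kn; rewrite ?leq_subr ?leq_ord.
Qed.

(** The lowest nonzero coefficients of two nonzero series multiply to a nonzero coefficient of the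
    product. *)
Lemma muls_eq0 f g : f * g = 0 -> f = 0 \/ g = 0.
Proof.
case: (pselect (f = 0)) => [->|f0]; first by left.
case: (pselect (g = 0)) => [->|g0]; first by right.
have low h : h <> 0 -> exists2 n, h n != 0 & forall i, (i < n)%N -> h i = 0.
  move=> h0; have ex : exists n, h n != 0.
    apply: contrapT => nex; apply: h0; apply: funext => k.
    by apply/eqP; apply: contrapT => /negP hk; apply: nex; exists k.
  exists (ex_minn ex); case: ex_minnP => // n _ min i; apply: contraTeq => hi.
  by rewrite -leqNgt; apply: min.
have [n fn mf] := low _ f0; have [m gm mg] := low _ g0.
move/(congr1 (fun h : pseries p => h (n + m)%N)); rewrite mulsE zeros.
have lt : (n < (n + m).+1)%N by rewrite ltnS leq_addr.
rewrite (bigD1 (Ordinal lt)) //= big1 ?addr0; last first.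
  move=> i; rewrite -val_eqE /= neq_ltn => /orP[/mf ->|ni]; first by rewrite mul0r.
  by rewrite mg ?mulr0 // ltn_subLR ?ltn_add2r // -ltnS.
by move/eqP; rewrite addKn mulf_eq0 (negPf fn) (negPf gm).
Qed.

End SeriesTheory.

(** * p-adic integers, the series (1-x)^a, and series as measures on Z_p *)

HB.instance Definition _ (p : nat) := gen_eqMixin (padic p).

Definition res p n (a : padic p) : nat := sval a n.

Section Padic.
Variable p : nat.
Hypothesis hp : prime p.
Implicit Types a b c : padic p.

Let p_gt0 : (0 < p)%N := prime_gt0 hp.

Lemma padicP a b : (forall n, res n a = res n b) -> a = b.
Proof.
case: a b => [a Ha] [b Hb] e; have {e}e : a = b by apply: funext.
by case: _ / e Hb => Hb; congr exist; apply: Prop_irrelevance.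
Qed.

Lemma res_mod m n a : (n <= m)%N -> (res m a %% p ^ n)%N = res n a.
Proof.
elim: m => [|m IH]; first by rewrite leqn0 => /eqP ->; case: (svalP a 0%N).
rewrite leq_eqVlt => /orP[/eqP ->|]; first by case: (svalP a m.+1).
rewrite ltnS => nm; rewrite -(IH nm) /res; have [_ <-] := svalP a m.
by rewrite modn_dvdm // dvdn_exp2l.
Qed.

Lemma res_lt n a : (res n a < p ^ n)%N.
Proof. by rewrite -(res_mod a (leqnn n)) ltn_mod expn_gt0 p_gt0. Qed.

Lemma resD n a b : res n (padd a b) = ((res n a + res n b) %% p ^ n)%N.
Proof. by []. Qed.

Lemma paddC a b : padd a b = padd b a.
Proof. by apply: padicP => n; rewrite !resD addnC. Qed.

Lemma paddA a b c : padd a (padd b c) = padd (padd a b) c.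
Proof. by apply: padicP => n; rewrite !resD modnDmr modnDml addnA. Qed.

Lemma padd0 a : padd a (padic0 p) = a.
Proof. by apply: padicP => n; rewrite resD addn0 res_mod. Qed.

Lemma popp_proof a n :
  ((p ^ n - sval a n) %% p ^ n %% p ^ n = (p ^ n - sval a n) %% p ^ n)%N
  /\ ((p ^ n.+1 - sval a n.+1) %% p ^ n.+1 %% p ^ n = (p ^ n - sval a n) %% p ^ n)%N.
Proof.
split; first by rewrite modn_mod.
rewrite modn_dvdm; last by rewrite dvdn_exp2l.
apply/eqP; rewrite -(eqn_modDr (res n.+1 a)) subnK ?(ltnW (res_lt _ _)) //.
rewrite -[X in _ == X]modnDmr (res_mod a (leqnSn n)) subnK ?(ltnW (res_lt _ _)) //.
by rewrite modnn expnS modnMl.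
Qed.

Definition popp a : padic p :=
  exist _ (fun n => (p ^ n - sval a n) %% p ^ n)%N (popp_proof a).

Lemma paddN a : padd a (popp a) = padic0 p.
Proof.
apply: padicP => n; rewrite resD /popp {2}/res /= modnDmr subnKC ?modnn //.
exact: ltnW (res_lt _ _).
Qed.

Lemma padd_congr n a a' b : res n a = res n a' -> res n (padd a b) = res n (padd a' b).
Proof. by move=> e; rewrite !resD e. Qed.

Lemma padd_cancel n a a' b : res n (padd a b) = res n (padd a' b) -> res n a = res n a'.
Proof. by move/(padd_congr (popp b)); rewrite -!paddA paddN !padd0. Qed.

Lemma poppK a : popp (popp a) = a.
Proof.
apply: padicP => n; apply: (@padd_cancel _ _ _ (popp a)).
by rewrite paddN paddC paddN.
Qed.

Lemma poppD a b : popp (padd a b) = padd (popp a) (popp b).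
Proof.
apply: padicP => n; apply: (@padd_cancel _ _ _ (padd a b)); congr (res n _).
rewrite paddC paddN [padd a b]paddC paddA -[padd (padd (popp a) _) b]paddA.
by rewrite [padd (popp b) b]paddC paddN padd0 paddC paddN.
Qed.

Lemma popp0 : popp (padic0 p) = padic0 p.
Proof. by rewrite -[LHS]padd0 paddC paddN. Qed.

Lemma res_le m n a b : (n <= m)%N -> res m a = res m b -> res n a = res n b.
Proof. by move=> nm e; rewrite -(res_mod a nm) -(res_mod b nm) e. Qed.

Lemma res_popp_eq0 n a : res n (popp a) = 0%N <-> res n a = 0%N.
Proof.
suff H b : res n b = 0%N -> res n (popp b) = 0%N by split=> [/H|/H //]; rewrite poppK.
move=> e; have : res n b = res n (padic0 p) by [].
by move/(padd_congr (popp b)); rewrite paddN paddC padd0.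
Qed.

Lemma ppow_proof k n : (p ^ k %% p ^ n %% p ^ n = p ^ k %% p ^ n)%N
  /\ (p ^ k %% p ^ n.+1 %% p ^ n = p ^ k %% p ^ n)%N.
Proof. by rewrite modn_mod modn_dvdm // dvdn_exp2l. Qed.

Definition ppow k : padic p := exist _ (fun n => p ^ k %% p ^ n)%N (ppow_proof k).

(** The k-th term has valuation exactly k. Both p^k and -p^k qualify, so f and f' are treated at
    once. *)
Definition valuation_seq (beta : nat -> padic p) :=
  forall k, res k (beta k) = 0%N /\ res k.+1 (beta k) <> 0%N.

Lemma valuation_ppow : valuation_seq ppow.
Proof.
move=> k; split; first by rewrite /res /= modnn.
rewrite /res /= modn_small ?ltn_exp2l ?prime_gt1 //.
by apply/eqP; rewrite -lt0n expn_gt0 p_gt0.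
Qed.

Lemma valuation_popp beta : valuation_seq beta -> valuation_seq (popp \o beta).
Proof. by move=> vb k; have [v1 v2] := vb k; split=> /=; rewrite res_popp_eq0. Qed.

Lemma valuation_inj beta k l : valuation_seq beta ->
  res l.+1 (beta k) = res l.+1 (beta l) -> k = l.
Proof.
move=> vb e; have [v0 v1] := vb l; have [w0 w1] := vb k.
case: (ltngtP k l) => // kl.
  case: w1; rewrite -(res_mod _ kl); have := res_le (leqnSn l) e; rewrite v0 => ->.
  exact: mod0n.
by case: v1; rewrite -e -(res_mod _ kl) w0 mod0n.
Qed.

(** Each entry other than [b] differs from [b] at some level, and the maximum of these levels works.
    This isolates an atom of a measure in a ball. *)
Lemma separate (s : seq (padic p)) b :
  exists E, forall n a, (E <= n)%N -> a \in s -> res n a = res n b -> a = b.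
Proof.
elim: s => [|c s [E HE]]; first by exists 0%N.
case: (pselect (c = b)) => [->|cb].
  by exists E => n a En; rewrite inE => /orP[/eqP//|as_ e]; apply: (HE _ _ En as_ e).
have [m hm] : exists m, res m c <> res m b.
  apply: contrapT => h; apply: cb; apply: padicP => m.
  by apply: contrapT => hm; apply: h; exists m.
exists (maxn E m) => n a; rewrite geq_max => /andP[En mn]; rewrite inE => /orP[/eqP ->|as_].
  by move/(res_le mn).
by move=> e; apply: (HE _ _ En as_ e).
Qed.

(* Cantor's diagonal argument: the new digit is 1 or 0, whichever separates from g m modulo p^(m+1). *)
Fixpoint diag (g : nat -> padic p) n : nat :=
  if n is m.+1 then (diag g m + (if res m.+1 (g m) == diag g m then p ^ m else 0))%N else 0%N.

Lemma diag_lt g n : (diag g n < p ^ n)%N.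
Proof.
elim: n => [|n IH] //=; have p1 := prime_gt1 hp.
have : (p ^ n + p ^ n <= p ^ n.+1)%N by rewrite expnS addnn -mul2n leq_pmul2r ?expn_gt0 ?p_gt0.
by case: ifP => _ h; apply: leq_trans h; rewrite ?addn0; lia.
Qed.

Lemma diag_proof g n : (diag g n %% p ^ n = diag g n)%N /\ (diag g n.+1 %% p ^ n = diag g n)%N.
Proof.
split; first by rewrite modn_small ?diag_lt.
by rewrite /=; case: ifP => _; rewrite ?addn0 ?modnDr modn_small ?diag_lt.
Qed.

Lemma padic_uncountable (g : nat -> padic p) : exists a, forall n, a <> g n.
Proof.
exists (exist _ (diag g) (diag_proof g)) => n /(congr1 (res n.+1)); rewrite {1}/res /=.
have := expn_gt0 p n; rewrite p_gt0 /=.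
case: eqP => [-> |ne]; last by rewrite addn0 => _ /esym.
by move=> h /eqP; rewrite -[X in _ == X]addn0 eqn_add2l => /eqP h0; rewrite h0 in h.
Qed.

(** The series (1-x)^a, that is t^a; multiplication by it is [act a]. *)
Definition T a : pseries p := unit_coef a.

Lemma Frobenius_1subX m : (1 - 'X : {poly 'F_p}) ^+ (p ^ m) = 1 - 'X ^+ (p ^ m).
Proof.
have chP : p \in [pchar {poly 'F_p}] by rewrite (rmorph_pchar (@polyC 'F_p)) // pchar_Fp.
elim: m => [|m IH]; first by rewrite !expr1.
by rewrite expnSr exprM IH -(pFrobenius_autE chP) pFrobenius_autB_comm ?pFrobenius_autE;
   [rewrite expr1n -exprM | apply: mulrC].
Qed.

(** Since (1-x)^(p^m) is 1 modulo x^(p^m), the exponent counts only modulo p^m. *)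
Lemma coef_1subX_mod m N i : (i < p ^ m)%N ->
  ((1 - 'X : {poly 'F_p}) ^+ (N %% p ^ m))`_i = ((1 - 'X) ^+ N)`_i.
Proof.
move=> im; rewrite {2}(divn_eq N (p ^ m)) exprD mulnC exprM Frobenius_1subX.
elim: (N %/ _)%N => [|q IH]; first by rewrite mul1r.
by rewrite exprS -mulrA mulrBl mul1r coefB coefXnM im subr0.
Qed.

Lemma T_coef m a i : (i < p ^ m)%N -> T a i = ((1 - 'X : {poly 'F_p}) ^+ res m a)`_i.
Proof.
move=> im; rewrite /T /unit_coef -/(res i.+1 a).
have ip : (i < p ^ i.+1)%N by apply: ltnW; rewrite ltn_expl ?prime_gt1.
case: (leqP m i.+1) => [mi|/ltnW im'].
  by rewrite -(coef_1subX_mod (res i.+1 a) im) res_mod.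
by rewrite -(coef_1subX_mod (res m a) ip) res_mod.
Qed.

Lemma T_padd a b : T (padd a b) = T a * T b.
Proof.
apply: funext => k; have kp : (k < p ^ k)%N by rewrite ltn_expl ?prime_gt1.
rewrite (T_coef _ kp) resD coef_1subX_mod // exprD coefM mulsE.
apply: eq_bigr => i _; rewrite !(@T_coef k) //; apply: leq_ltn_trans kp.
  exact: leq_subr.
exact: leq_ord.
Qed.

Lemma T_agree1 a n : res n a = 0%N -> agree (p ^ n) (T a) 1.
Proof. by move=> e i ip; rewrite (T_coef _ ip) e expr0 coef1 ones. Qed.

Lemma T0 : T (padic0 p) = 1.
Proof.
apply: funext => k; apply: (@T_agree1 _ k) => //.
by rewrite ltn_expl ?prime_gt1.
Qed.

Lemma TN a : T a * T (popp a) = 1.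
Proof. by rewrite -T_padd paddN T0. Qed.

Lemma T_neq0 a : T a <> 0.
Proof. by move=> e; have := TN a; rewrite e mul0r => /eqP; rewrite eq_sym oner_eq0. Qed.

Lemma char_pseries (f : pseries p) : f *+ p = 0.
Proof.
rewrite -mulr_natr; suff -> : (p%:R : pseries p) = 0 by rewrite mulr0.
apply: funext => k.
suff -> n : (n%:R : pseries p) k = n%:R * (1 : pseries p) k by rewrite pchar_Fp_0 // mul0r.
by elim: n => [|n IH]; rewrite ?mul0r // mulrS addsE IH [in RHS]mulrS mulrDl mul1r.
Qed.

(* The coefficient of (1-x)^j in f mod x^(p^n), summed against h: it pairs the measure f on Z_p with the locally constant function h. *)
Definition measure n (h : nat -> 'F_p) (f : pseries p) : 'F_p :=
  \sum_(j < p ^ n) h j * (trunc (p ^ n) f \Po (1 - 'X))`_j.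

Lemma measure_agree n h f g : agree (p ^ n) f g -> measure n h f = measure n h g.
Proof.
move=> e; apply: eq_bigr => j _; congr (_ * (_ \Po _)`_j).
by apply/polyP => i; rewrite !coef_poly; case: ifP => // /e.
Qed.

Lemma measureD n h f g : measure n h (f + g) = measure n h f + measure n h g.
Proof.
rewrite -big_split /=; apply: eq_bigr => j _.
rewrite -mulrDr -coefD -comp_polyD; congr (_ * (_ \Po _)`_j).
by apply/polyP => i; rewrite coefD !coef_poly; case: ifP; rewrite ?addr0.
Qed.

Lemma measure0 n h : measure n h 0 = 0.
Proof. by apply: (addrI (measure n h 0)); rewrite -measureD !addr0. Qed.

Lemma measure_sum n h I (r : seq I) P F :
  measure n h (\sum_(i <- r | P i) F i) = \sum_(i <- r | P i) measure n h (F i).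
Proof. by exact: (big_morph _ (measureD n h) (measure0 n h)). Qed.

Lemma measureN n h f : measure n h (- f) = - measure n h f.
Proof. by apply: (addrI (measure n h f)); rewrite -measureD !subrr measure0. Qed.

(** Substituting 1-x for x turns (1-x)^N with N < p^n into x^N, so t^a is the Dirac mass at a. *)
Lemma measure_T n h a : measure n h (T a) = h (res n a).
Proof.
have -> : measure n h (T a) = \sum_(j < p ^ n) h j * ((j : nat) == res n a)%:R.
  apply: eq_bigr => j _; congr (_ * _).
  have -> : trunc (p ^ n) (T a) = (1 - 'X : {poly 'F_p}) ^+ res n a.
    apply/polyP => i; rewrite coef_poly; case: ltnP => [ip|pi]; first exact: T_coef.
    rewrite nth_default //; apply: leq_trans pi; apply: leq_trans (res_lt n a).
    have sz : (size ((1 - 'X)%R : {poly 'F_p}) <= 2)%N.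
      by rewrite (leq_trans (size_polyD _ _)) // size_opp size_polyX size_poly1.
    apply: leq_trans (size_exp_leq _ _) _; rewrite ltnS.
    by case: (size _) sz => [|[|[|]]] //= _; rewrite ?mul0n ?mul1n.
  rewrite rmorphXn /= comp_polyB comp_polyX comp_polyC.
  by rewrite opprB addrCA subrr addr0 coefXn.
rewrite (bigD1 (Ordinal (res_lt n a))) //= eqxx mulr1 big1 ?addr0 // => j.
by rewrite -val_eqE /= => /negPf ->; rewrite mulr0.
Qed.

End Padic.

(** * The group ring F_p[Z_p], its involution, and its independence from the limit series *)

Section GroupRing.
Variable p : nat.
Hypothesis hp : prime p.
Implicit Types (a b c : padic p) (r : seq (padic p)) (y z : pseries p).

(* In characteristic p, finite multisets of group elements already give all of the group ring F_p[Z_p]. *)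
Definition ev r : pseries p := \sum_(a <- r) T a.
Definition evbar r : pseries p := \sum_(a <- r) T (popp hp a).

Lemma ev_cat r r' : ev (r ++ r') = ev r + ev r'. Proof. exact: big_cat. Qed.
Lemma evbar_cat r r' : evbar (r ++ r') = evbar r + evbar r'. Proof. exact: big_cat. Qed.

Lemma ev_map_padd a r : ev [seq padd a b | b <- r] = T a * ev r.
Proof. by rewrite /ev big_map mulr_sumr; apply: eq_bigr => b _; rewrite T_padd. Qed.

Lemma evbar_map_padd a r : evbar [seq padd a b | b <- r] = T (popp hp a) * evbar r.
Proof. by rewrite /evbar big_map mulr_sumr; apply: eq_bigr => b _; rewrite poppD T_padd. Qed.

Lemma ev_map_popp r : ev (map (popp hp) r) = evbar r.
Proof. by rewrite /ev big_map. Qed.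

Lemma evbar_map_popp r : evbar (map (popp hp) r) = ev r.
Proof. by rewrite /evbar big_map; apply: eq_bigr => a _; rewrite poppK. Qed.

(** In characteristic p, repeating the list p-1 times negates both sums. *)
Lemma ev_opp r : exists r', ev r' = - ev r /\ evbar r' = - evbar r.
Proof.
exists (flatten (nseq p.-1 r)).
have E (F : seq (padic p) -> pseries p) : F [::] = 0 ->
    {morph F : s t / s ++ t >-> s + t} -> F (flatten (nseq p.-1 r)) = - F r.
  move=> F0 FD; have -> n : F (flatten (nseq n r)) = F r *+ n.
    by elim: n => [|n IH]; rewrite ?mulr0n ?F0 //= FD IH mulrS.
  apply: (addrI (F r)).
  by rewrite -mulrS prednK ?prime_gt0 // subrr char_pseries.
by split; apply: E; rewrite ?/ev ?/evbar ?big_nil //; [apply: ev_cat | apply: evbar_cat].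
Qed.

Lemma sum_count0 (F : padic p -> pseries p) r :
  (forall b, (p %| count_mem b r)%N) -> \sum_(a <- r) F a = 0.
Proof.
move=> dvd; rewrite -big_undup_iterop_count big1_seq //= => a _.
have /dvdnP[m ->] := dvd a.
have -> n : iterop n +%R (F a) 0 = F a *+ n by [].
by rewrite mulnC mulrnA char_pseries // mul0rn.
Qed.

Lemma measure_ev n h r : measure n h (ev r) = \sum_(a <- r) h (res n a).
Proof. by rewrite measure_sum; apply: eq_bigr => a _; rewrite measure_T. Qed.

Variable beta : nat -> padic p.
Hypothesis vbeta : valuation_seq beta.

(** The infinite sum of the [T (beta k) - 1]. Under [valuation_seq] the k-th term vanishes below
    degree p^k, so terms with k > i do not affect coefficient i. *)
Definition lim : pseries p := fun i => (\sum_(k < i.+1) (T (beta k) - 1) : pseries p) i.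

Lemma lim_agree n : agree n lim (\sum_(k < n) (T (beta k) - 1)).
Proof.
move=> i ilt; rewrite /lim !sums.
rewrite -!(big_mkord xpredT (fun k => (T (beta k) - 1 : pseries p) i)).
rewrite (big_cat_nat (leq0n i.+1) ilt) /=.
rewrite [X in _ = _ + X]big1_seq ?addr0 // => k /andP[_]; rewrite mem_index_iota => /andP[ik _].
have [bk _] := vbeta k; rewrite addsE oppsE (T_agree1 hp bk) ?subrr //.
by apply: ltn_trans ik _; rewrite ltn_expl ?prime_gt1.
Qed.

(* The measure lim has infinitely many atoms beta k accumulating at 0, which no finite combination of translates can cancel. *)
Lemma ev_lim_independent r1 r2 : ev r1 + ev r2 * lim = 0 ->
  forall b, (p %| count_mem b r2)%N.
Proof.
move=> e0 b0.
have [D HD] := separate r2 b0.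
have [E HE] := separate (r1 ++ [seq padd b (beta k) | b <- r2, k <- iota 0 D]) b0.
(* The test ball is centred at [c] = b0 + beta k0 and has radius p^n: [c] agrees with [b0] modulo
   p^k0 but not modulo p^n. The bound [D] isolates [b0] within [r2]; [E] isolates it from [r1] and
   from the b + beta k with k < D. *)
pose k0 := maxn D E; pose n := k0.+1; pose c := padd b0 (beta k0).
pose h j : 'F_p := (j == res n c)%:R.
have c_b0 m : (m <= k0)%N -> res m c = res m b0.
  move=> mk; have [v0 _] := vbeta k0; rewrite /c resD -(res_mod (beta k0) mk) v0 mod0n addn0.
  exact: res_mod.
have nc_b0 : res n c <> res n b0.
  move=> e; have [_] := vbeta k0; apply; rewrite -/n.
  have : res n (padd (beta k0) b0) = res n (padd (padic0 p) b0).
    by rewrite paddC -/c e paddC padd0.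
  by move/(padd_cancel hp).
have far a m : (m <= k0)%N -> (res m a = res m b0 -> a = b0) -> res n a <> res n c.
  move=> mk ha eac; have ab : a = b0.
    by apply: ha; rewrite -c_b0 //; apply: res_le eac => //; apply: leqW.
  by apply: nc_b0; rewrite -eac ab.
have Dk : (D <= k0)%N by rewrite leq_maxl.
have Ek : (E <= k0)%N by rewrite leq_maxr.
(* Of the atoms b + beta k, only b0 + beta k0 lies in the ball: [E] excludes k < D, while k >= D
   puts b within p^D of [b0], whence b = b0 and then k = k0. *)
have term b k : b \in r2 -> h (res n (padd b (beta k))) = ((b == b0) && (k == k0))%:R.
  move=> br; rewrite /h; congr (_%:R); congr (nat_of_bool _).
  apply/eqP/andP => [eq|[/eqP -> /eqP ->] //].
  case: (ltnP k D) => kD.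
    case: (@far (padd b (beta k)) E) => //; apply: HE => //.
    rewrite mem_cat; apply/orP; right; apply/allpairsP; exists (b, k).
    by rewrite mem_iota add0n.
  have bb : b = b0.
    apply: (HD D) => //; rewrite -c_b0 // -(res_le (leqW Dk) eq).
    have [v0 _] := vbeta k; rewrite resD -[res D (beta k)](res_mod _ kD) v0 mod0n addn0.
    by rewrite res_mod.
  split; first by rewrite bb.
  apply/eqP; apply: (valuation_inj vbeta); move: eq; rewrite bb /c paddC [padd b0 _]paddC.
  exact: padd_cancel.
(* Pairing with [h] kills [ev r1] and leaves the multiplicity of [b0] in [r2] modulo p. *)
have /(congr1 (measure n h)) := e0; rewrite measureD measure0 measure_ev.
rewrite (_ : \sum_(a <- r1) _ = 0) ?add0r; last first.
  rewrite big1_seq // => a /= ar; rewrite /h; case: eqP => // eac; case: (@far a E) => //.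
  by apply: HE; rewrite // mem_cat ar.
have la : agree (p ^ n) (ev r2 * lim) (ev r2 * \sum_(k < p ^ n) (T (beta k) - 1)).
  by apply: agreeM => //; apply: lim_agree.
rewrite (measure_agree _ la) mulr_suml measure_sum.
have k0p : (k0 < p ^ n)%N by apply: ltnW; rewrite ltn_expl ?prime_gt1.
rewrite big_seq (eq_bigr (fun b => (b == b0)%:R : 'F_p)); last first.
  move=> b br; rewrite mulr_sumr measure_sum (bigD1 (Ordinal k0p)) //= big1 ?addr0.
    rewrite mulrBr mulr1 -T_padd // measureD measureN !measure_T // term // eqxx andbT.
    rewrite {1}/h (_ : (_ == res n c) = false) ?subr0 //.
    by apply/eqP; apply: (@far b D) => //; apply: HD.
  move=> k; rewrite -val_eqE /= => kk0.
  rewrite mulrBr mulr1 -T_padd // measureD measureN !measure_T // term // (negPf kk0) andbF.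
  rewrite {1}/h (_ : (_ == res n c) = false) ?subr0 //.
  by apply/eqP; apply: (@far b D) => //; apply: HD.
rewrite -big_seq => H.
rewrite (dvdn_pcharf (pchar_Fp hp)) -H -sum1_count natr_sum big_mkcond /=.
by apply/eqP; apply: eq_bigr => b _; case: (b == b0).
Qed.

(** Multiplicities divisible by p make every sum over [r2] vanish, the conjugate one included. *)
Lemma ev_lim_eq0 r1 r2 : ev r1 + ev r2 * lim = 0 -> ev r2 = 0 /\ evbar r2 = 0.
Proof. by move/ev_lim_independent => dvd; split; apply: sum_count0. Qed.

(** The involution t^a -> t^-a is thus well defined on the image of the group ring in F_p[[x]]. *)
Lemma ev_eq0 r : ev r = 0 -> evbar r = 0.
Proof.
by move=> e; have [|] := @ev_lim_eq0 [::] r; rewrite // e mul0r addr0 /ev big_nil.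
Qed.

End GroupRing.

(** * Semilinear maps separating the limit series from 1 *)

Section Semilinear.
Variables (p : nat) (hp : prime p) (beta : nat -> padic p).
Hypothesis vbeta : valuation_seq beta.
Implicit Types (a : padic p) (r : seq (padic p)) (y z : pseries p).
Implicit Types (N : pseries p -> Prop) (L : pseries p -> pseries p).

(** [L] is a total function, constrained only on the submodule [N]. *)
Definition partial_semilinear N L :=
  (forall y z, N y -> N z -> N (y + z) /\ L (y + z) = L y + L z) /\
  (forall a y, N y -> N (T a * y) /\ L (T a * y) = T (popp hp a) * L y).

Definition separating N L :=
  [/\ partial_semilinear N L, N 1, N (lim beta), L 1 = 0 & L (lim beta) <> 0].

(** Closure under addition suffices, because p y = 0. *)
Lemma semilinear_zero N L y : partial_semilinear N L -> N y -> N 0 /\ L 0 = 0.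
Proof.
move=> [ND _] Ny; have Nn n : N (y *+ n.+1).
  by elim: n => [|n IH] //; rewrite mulrS; apply: (ND _ _ Ny IH).1.
have N0 : N 0 by have := Nn p.-1; rewrite prednK ?prime_gt0 // char_pseries.
by split=> //; apply: (addrI (L 0)); rewrite -(ND _ _ N0 N0).2 !addr0.
Qed.

Lemma semilinear_ev N L r y : partial_semilinear N L -> N y ->
  N (ev r * y) /\ L (ev r * y) = evbar hp r * L y.
Proof.
move=> NL Ny; have [N0 L0] := semilinear_zero NL Ny; have [ND NT] := NL.
elim: r => [|a r [IN IL]]; first by rewrite /ev /evbar !big_nil !mul0r.
have [NTy LTy] := NT a y Ny; rewrite /ev /evbar !big_cons !mulrDl.
by have [? ->] := ND _ _ NTy IN; rewrite IL LTy.
Qed.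

(** On the submodule spanned by 1 and the limit, [L] sends r1 + r2 [lim beta] to the conjugate of
    r2. This is well defined by [ev_lim_eq0]. *)
Lemma separating_base : exists N L, separating N L.
Proof.
pose N y := exists r : seq (padic p) * seq (padic p), y = ev r.1 + ev r.2 * lim beta.
pose rep y := epsilon (inhabits ([::], [::])) (fun r : seq (padic p) * seq (padic p) => y = ev r.1 + ev r.2 * lim beta).
pose L y := evbar hp (rep y).2.
have LE r1 r2 : L (ev r1 + ev r2 * lim beta) = evbar hp r2.
  set y := _ + _.
  have : y = ev (rep y).1 + ev (rep y).2 * lim beta.
    by apply: (epsilon_spec _ (fun r : seq (padic p) * seq (padic p) => y = ev r.1 + ev r.2 * lim beta)); exists (r1, r2).
  rewrite /L; case: (rep y) => s1 s2 /=; rewrite /y => e.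
  have [s1' [e1 _]] := ev_opp hp s1; have [s2' [e2 eb2]] := ev_opp hp s2.
  have [|_ /eqP] := @ev_lim_eq0 p hp beta vbeta (r1 ++ s1') (r2 ++ s2').
    rewrite !ev_cat e1 e2; transitivity (ev r1 + ev r2 * lim beta - (ev s1 + ev s2 * lim beta)).
      by ring.
    by rewrite e subrr.
  by rewrite evbar_cat eb2 subr_eq0 => /eqP.
have e0 : ev [::] = 0 :> pseries p by rewrite /ev big_nil.
have e1 : ev [:: padic0 p] = 1 by rewrite /ev big_seq1 T0.
have f1 : 1 = ev [:: padic0 p] + ev [::] * lim beta by rewrite e0 e1 mul0r addr0.
have flim : lim beta = ev [::] + ev [:: padic0 p] * lim beta by rewrite e0 e1 mul1r add0r.
exists N, L; split.
- split.
  + move=> _ _ [r ->] [s ->].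
    have e : ev r.1 + ev r.2 * lim beta + (ev s.1 + ev s.2 * lim beta)
        = ev (r.1 ++ s.1) + ev (r.2 ++ s.2) * lim beta by rewrite !ev_cat; ring.
    by split; [exists (r.1 ++ s.1, r.2 ++ s.2) | rewrite e !LE evbar_cat].
  + move=> a _ [r ->].
    have e : T a * (ev r.1 + ev r.2 * lim beta)
        = ev (map (padd a) r.1) + ev (map (padd a) r.2) * lim beta.
      by rewrite !ev_map_padd //; ring.
    by split; [exists (map (padd a) r.1, map (padd a) r.2) | rewrite e !LE evbar_map_padd].
- by exists ([:: padic0 p], [::]).
- by exists ([::], [:: padic0 p]).
- by rewrite f1 LE /evbar big_nil.
- by rewrite flim LE /evbar big_seq1 popp0; apply: T_neq0.
Qed.

Lemma separating_extend N L g : separating N L ->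
  exists N' L', [/\ separating N' L', N' g & forall y, N y -> N' y].
Proof.
move=> [NL N1 Nl L1 Ll]; have [ND NT] := NL.
case: (pselect (exists2 r, ev r <> 0 & N (ev r * g))) => [[r r0 Ng]|free].
  (* g is torsion modulo N: y |-> L (ev r * y) is L up to a nonzero factor, and is defined at g. *)
  exists (fun y => N (ev r * y)), (fun y => L (ev r * y)); split=> //; last first.
    by move=> y Ny; apply: (semilinear_ev r NL Ny).1.
  split.
  - split.
      by move=> y z Ny Nz; rewrite mulrDr; apply: ND.
    by move=> a y Ny; rewrite mulrCA; apply: NT.
  - exact: (semilinear_ev r NL N1).1.
  - exact: (semilinear_ev r NL Nl).1.
  - by rewrite (semilinear_ev r NL N1).2 L1 mulr0.
  (* The conjugate of a nonzero group ring element is nonzero: conjugating again would give [ev r] =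
     0. *)
  - rewrite (semilinear_ev r NL Nl).2 => /muls_eq0[|//]; rewrite -ev_map_popp => /(ev_eq0 hp vbeta).
    by rewrite evbar_map_popp.
(* Here no nonzero group ring element carries [g] into [N], so the sum of [N] and the multiples of
   [g] is direct, and [L] extends by 0 on the latter. *)
pose N' y := exists n r, N n /\ y = n + ev r * g.
pose rep y := epsilon (inhabits 0) (fun n => N n /\ exists r, y = n + ev r * g).
pose L' y := L (rep y).
have LE n r : N n -> L' (n + ev r * g) = L n.
  move=> Nn; set y := _ + _.
  have : N (rep y) /\ exists r, y = rep y + ev r * g.
    apply: (epsilon_spec _ (fun n => N n /\ exists r, y = n + ev r * g)).
    by exists n; split=> //; exists r.
  rewrite /L'; move: (rep y) => m [Nm [s]]; rewrite /y => e; congr L.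
  (* The list [u'] represents -1, so that subtraction in [N] becomes a group ring action. *)
  have [s' [es _]] := ev_opp hp s; have [u' [eu _]] := ev_opp hp [:: padic0 p].
  have eu1 : ev u' = -1 by rewrite eu /ev big_seq1 T0.
  have rs : ev (r ++ s') = 0.
    apply: contrapT => nz; apply: free; exists (r ++ s') => //.
    have -> : ev (r ++ s') * g = m + ev u' * n.
      rewrite ev_cat es eu1; transitivity (n + ev r * g - ev s * g - n); first by ring.
      by rewrite e; ring.
    by apply: (ND _ _ Nm _).1; apply: (semilinear_ev u' NL Nn).1.
  have ers : ev r = ev s by apply/eqP; rewrite -subr_eq0 -es -ev_cat rs.
  by apply: (addIr (ev r * g)); rewrite e ers.
have emb y : y = y + ev [::] * g by rewrite /ev big_nil mul0r addr0.
have [N0 L0] := semilinear_zero NL N1.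
exists N', L'; split; last first.
- by move=> y Ny; exists y, [::].
- by exists 0, [:: padic0 p]; split=> //; rewrite /ev big_seq1 T0 // mul1r add0r.
- split.
  + split.
    * move=> _ _ [n [r [Nn ->]]] [m [s [Nm ->]]]; have [Nnm Lnm] := ND _ _ Nn Nm.
      have e : n + ev r * g + (m + ev s * g) = (n + m) + ev (r ++ s) * g.
        by rewrite ev_cat; ring.
      by split; [exists (n + m), (r ++ s) | rewrite e !LE].
    * move=> a _ [n [r [Nn ->]]]; have [Na La] := NT a _ Nn.
      have e : T a * (n + ev r * g) = T a * n + ev (map (padd a) r) * g.
        by rewrite ev_map_padd //; ring.
      by split; [exists (T a * n), (map (padd a) r) | rewrite e !LE].
  + by exists 1, [::].
  + by exists (lim beta), [::].
  + by rewrite (emb 1) LE.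
  + by rewrite (emb (lim beta)) LE.
Qed.

(* Working with finitely many series at a time avoids both Zorn's lemma and the fraction field of F_p[Z_p]. *)
Lemma separating_exists (s : seq (pseries p)) :
  exists N L, separating N L /\ forall y, y \in s -> N y.
Proof.
elim: s => [|g s [N [L [NL Ns]]]].
  by have [N [L NL]] := separating_base; exists N, L.
have [N' [L' [NL' Ng NN']]] := separating_extend g NL.
by exists N', L'; split=> // y; rewrite inE => /orP[/eqP -> //|/Ns/NN'].
Qed.

End Semilinear.

(** * Chains of the bar complex and torus cycles *)

Section Chains.
Variable p : nat.

Definition delta (K : Type) (k k' : K) : 'F_p :=
  if excluded_middle_informative (k = k') then 1 else 0.

Lemma delta_refl (K : Type) (k : K) : delta k k = 1.
Proof. by rewrite /delta; case: excluded_middle_informative => [?|[]]. Qed.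

Lemma delta_neq (K : Type) (k k' : K) : k <> k' -> delta k k' = 0.
Proof. by rewrite /delta; case: excluded_middle_informative => [?|?]. Qed.

Definition pairing (K : Type) (phi : K -> 'F_p) (c : fsum p K) : 'F_p :=
  \sum_(x <- c) x.2 * phi x.1.

Lemma coef_pairing (K : Type) (c : fsum p K) k : coef c k = pairing (fun x => delta x k) c.
Proof.
apply: eq_bigr => x _; rewrite /delta.
by case: excluded_middle_informative => ?; rewrite ?mulr1 ?mulr0.
Qed.

Lemma pairing_cat (K : Type) phi (c c' : fsum p K) :
  pairing phi (c ++ c') = pairing phi c + pairing phi c'.
Proof. exact: big_cat. Qed.

Lemma pairing_csub (K : Type) phi (c c' : fsum p K) :
  pairing phi (csub c c') = pairing phi c - pairing phi c'.
Proof.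
rewrite /csub pairing_cat; congr (_ + _); rewrite /pairing big_map -sumrN.
by apply: eq_bigr => x _; rewrite mulNr.
Qed.

Lemma coef_cat (K : Type) (c c' : fsum p K) k : coef (c ++ c') k = coef c k + coef c' k.
Proof. by rewrite !coef_pairing pairing_cat. Qed.

Lemma coef_csub (K : Type) (c c' : fsum p K) k : coef (csub c c') k = coef c k - coef c' k.
Proof. by rewrite !coef_pairing pairing_csub. Qed.

Lemma coef_nil (K : Type) (k : K) : coef ([::] : fsum p K) k = 0.
Proof. exact: big_nil. Qed.

Lemma coef_cons (K : Type) x (c : fsum p K) k : coef (x :: c) k = x.2 * delta x.1 k + coef c k.
Proof. by rewrite !coef_pairing /pairing big_cons. Qed.

(** Grouping entries by key shows that a pairing depends only on the coefficients. *)
Lemma pairing_support (K : eqType) phi (c : fsum p K) (s : seq K) :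
  uniq s -> {subset [seq x.1 | x <- c] <= s} ->
  pairing phi c = \sum_(k <- s) coef c k * phi k.
Proof.
move=> us; elim: c => [|x c IH] sub.
  by rewrite /pairing big_nil big1 // => k _; rewrite coef_nil mul0r.
have xs : x.1 \in s by apply: sub; rewrite inE eqxx.
have {}IH := IH (fun k kc => sub k (mem_behead (s := _ :: _) kc)).
rewrite /pairing big_cons -/(pairing phi c) IH.
rewrite [RHS](eq_bigr (fun k => x.2 * delta x.1 k * phi k + coef c k * phi k)); last first.
  by move=> k _; rewrite coef_cons mulrDl.
rewrite big_split /=; congr (_ + _); rewrite (bigD1_seq x.1) //= big1 ?addr0.
  by rewrite delta_refl mulr1.
by move=> k /eqP kx; rewrite delta_neq ?mulr0 ?mul0r // => /esym.
Qed.

Lemma pairing_chain_eq (K : Type) phi (c c' : fsum p K) :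
  chain_eq c c' -> pairing phi c = pairing phi c'.
Proof.
move=> e; pose s := @undup {classic K} ([seq x.1 | x <- c] ++ [seq x.1 | x <- c']).
rewrite (@pairing_support {classic K} phi c s) ?undup_uniq //; last first.
  by move=> k kc; rewrite mem_undup mem_cat kc.
rewrite (@pairing_support {classic K} phi c' s) ?undup_uniq //; last first.
  by move=> k kc; rewrite mem_undup mem_cat kc orbT.
by apply: eq_bigr => k _; rewrite e.
Qed.

Lemma coef_push (K K' : Type) (f : K -> K') (c : fsum p K) k :
  coef (push f c) k = pairing (fun x => delta (f x) k) c.
Proof. by rewrite coef_pairing /pairing big_map. Qed.

Lemma push_chain_eq (K K' : Type) (f : K -> K') (c c' : fsum p K) :
  chain_eq c c' -> chain_eq (push f c) (push f c').
Proof. by move=> e k; rewrite !coef_push; apply: pairing_chain_eq. Qed.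

Variables (G : Type) (mul : G -> G -> G).

Lemma pairing_d3 (phi : G * G -> 'F_p) (w : fsum p (G * G * G)) :
  pairing phi (d3 mul w) = \sum_(x <- w) x.2 *
    (phi (x.1.1.2, x.1.2) - phi (mul x.1.1.1 x.1.1.2, x.1.2)
     + phi (x.1.1.1, mul x.1.1.2 x.1.2) - phi (x.1.1.1, x.1.1.2)).
Proof.
rewrite /pairing /d3 big_flatten big_map; apply: eq_bigr => x _.
by rewrite !big_cons big_nil /=; ring.
Qed.

Lemma boundary_chain_eq (b b' : fsum p (G * G)) :
  chain_eq b b' -> is_boundary2 mul b' -> is_boundary2 mul b.
Proof. by move=> e [w ew]; exists w => k; rewrite e. Qed.

Lemma boundary_csub (b b' : fsum p (G * G)) :
  is_boundary2 mul b -> is_boundary2 mul b' -> is_boundary2 mul (csub b b').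
Proof.
move=> [w e] [w' e']; exists (csub w w') => k.
rewrite coef_csub e e' !coef_pairing !pairing_d3 /csub big_cat big_map -sumrN /=.
by congr (_ + _); apply: eq_bigr => x _; rewrite mulNr.
Qed.

Lemma boundary_cat (b b' : fsum p (G * G)) :
  is_boundary2 mul b -> is_boundary2 mul b' -> is_boundary2 mul (b ++ b').
Proof.
move=> [w e] [w' e']; exists (w ++ w') => k.
by rewrite coef_cat e e' !coef_pairing !pairing_d3 big_cat.
Qed.

(* The image in H_2 of the fundamental class of a torus, for a commuting pair (g, h). *)
Definition torus (g h : G) : fsum p (G * G) := [:: ((g, h), 1); ((h, g), -1)].

Lemma torus_csub_cycle g h g' h' : mul g h = mul h g -> mul g' h' = mul h' g' ->
  is_cycle2 mul (csub (torus g h) (torus g' h')).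
Proof.
by move=> gh gh' k; rewrite /torus /csub /d2 /= gh gh' !coef_cons coef_nil /=; ring.
Qed.

(** The 3-chain is the shuffle product of [g1|g2] with [h]. *)
Lemma torusD g1 g2 h : mul g1 h = mul h g1 -> mul g2 h = mul h g2 ->
  is_boundary2 mul (csub (torus g1 h ++ torus g2 h) (torus (mul g1 g2) h)).
Proof.
move=> e1 e2; exists [:: ((g1, g2, h), 1); ((g1, h, g2), -1); ((h, g1, g2), 1)] => k.
by rewrite /torus /csub /d3 /= e1 e2 !coef_cons coef_nil /=; ring.
Qed.

(** Conjugation acts trivially on homology. The 3-chain is the standard prism [t|g|h] - [g'|t|h] +
    [g'|h'|t], minus the same with the two arguments exchanged. *)
Lemma torus_conj t g h g' h' : mul g h = mul h g -> mul g' h' = mul h' g' ->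
  mul t g = mul g' t -> mul t h = mul h' t ->
  is_boundary2 mul (csub (torus g h) (torus g' h')).
Proof.
move=> gh gh' eg eh.
exists [:: ((t, g, h), 1); ((g', t, h), -1); ((g', h', t), 1);
           ((t, h, g), -1); ((h', t, g), 1); ((h', g', t), -1)] => k.
by rewrite /torus /csub /d3 /= gh gh' eg eh !coef_cons coef_nil /=; ring.
Qed.

End Chains.

(** * The double lamplighter group, its finite quotients, and the classes z_a *)

Section Lamplighter.
Variables (p : nat) (hp : prime p).
Implicit Types (a : padic p) (m n f : pseries p) (x y : DL p).

Lemma DLmulE m n a m' n' a' :
  DLmul (m, n, a) (m', n', a') = (m + T a * m', n + T a * n', padd a a').
Proof. by []. Qed.

Lemma DL1E : DLone p = (0, 0, padic0 p). Proof. by []. Qed.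

Lemma DLmulA x y z : DLmul x (DLmul y z) = DLmul (DLmul x y) z.
Proof.
case: x y z => [[m n] a] [[m' n'] a'] [[m'' n''] a'']; rewrite !DLmulE paddA T_padd //.
by congr (_, _, _); ring.
Qed.

Lemma DLmul1 x : DLmul x (DLone p) = x.
Proof. by case: x => [[m n] a]; rewrite DL1E DLmulE padd0 !mulr0 !addr0. Qed.

Definition DLinv x : DL p :=
  (- (T (popp hp x.2) * x.1.1), - (T (popp hp x.2) * x.1.2), popp hp x.2).

Lemma DLmulV x : DLmul x (DLinv x) = DLone p.
Proof.
case: x => [[m n] a]; rewrite /DLinv DL1E DLmulE paddN /=.
by congr (_, _, _); rewrite mulrN mulrA TN mul1r subrr.
Qed.

Lemma DLmulVx x : DLmul (DLinv x) x = DLone p.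
Proof.
case: x => [[m n] a]; rewrite /DLinv DL1E DLmulE paddC paddN /=.
by congr (_, _, _); rewrite addNr.
Qed.

Lemma DL1mul x : DLmul (DLone p) x = x.
Proof. by case: x => [[m n] a]; rewrite DL1E DLmulE paddC padd0 T0 // !mul1r !add0r. Qed.

Section Quotient.
Variable U : DL p -> Prop.
Hypothesis openU : open_normal_subgroup U.

(** Normality moves an element of [U] past [y]; hence [setmul] is the multiplication of the quotient
    and [coset U] induces a chain map. *)
Lemma setmul_coset x y : setmul (coset U x) (coset U y) = coset U (DLmul x y).
Proof.
have [[U1 [UM _]] Un _] := openU; rewrite predeqE => z; split.
  move=> [_ [_ [[u [Uu ->]] [[v [Uv ->]] ->]]]].
  have [u' yu] : exists u', DLmul y u' = DLmul u y.
    by exists (DLmul (DLinv y) (DLmul u y)); rewrite DLmulA DLmulV DL1mul.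
  exists (DLmul u' v); split; first by apply: UM => //; apply: Un yu.
  by rewrite -!DLmulA [DLmul y (DLmul u' v)]DLmulA yu !DLmulA.
move=> [u [Uu ->]]; exists x, (DLmul y u); split; first by exists (DLone p); rewrite DLmul1.
by split; [exists u | rewrite DLmulA].
Qed.

Lemma coset_eq x u : U u -> coset U (DLmul x u) = coset U x.
Proof.
have [[U1 [UM UV]] _ _] := openU; move=> Uu; rewrite predeqE => z; split.
  by move=> [v [Uv ->]]; exists (DLmul u v); split; [apply: UM | rewrite DLmulA].
move=> [v [Uv ->]]; exists (DLmul (DLinv u) v); split.
  by apply: UM => //; apply: (UV _ u) => //; rewrite DLmulVx.
by rewrite -DLmulA (DLmulA u) DLmulV DL1mul.
Qed.

Lemma boundary_quot_trivial (z : fsum p (DL p * DL p)) :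
  is_boundary2 (@DLmul p) z -> quot_trivial U z.
Proof.
move=> [w e]; exists w => k; rewrite (push_chain_eq _ e); congr (coef _ k).
elim: w {e} => //= x w IH; rewrite /d3 /= /push /= in IH *.
by rewrite -!setmul_coset IH.
Qed.

End Quotient.

Definition lamp1 m : DL p := (m, 0, padic0 p).
Definition lamp2 n : DL p := (0, n, padic0 p).

Lemma lamp1D m m' : DLmul (lamp1 m) (lamp1 m') = lamp1 (m + m').
Proof. by rewrite DLmulE T0 // padd0 !mul1r addr0. Qed.

Lemma lamp2D n n' : DLmul (lamp2 n) (lamp2 n') = lamp2 (n + n').
Proof. by rewrite DLmulE T0 // padd0 !mul1r addr0. Qed.

Lemma lampC m n : DLmul (lamp1 m) (lamp2 n) = DLmul (lamp2 n) (lamp1 m).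
Proof. by rewrite !DLmulE T0 // !mul1r !addr0 !add0r. Qed.

Lemma coset_lamp U : open_normal_subgroup U -> exists k, forall m m', agree k m m' ->
  coset U (lamp1 m) = coset U (lamp1 m') /\ coset U (lamp2 m) = coset U (lamp2 m').
Proof.
move=> oU; have [_ _ [k Uk]] := oU; exists k => m m' e.
have E i : (i < k)%N -> (m - m') i = 0 by move=> ik; rewrite addsE oppsE e // subrr.
split.
  have -> : lamp1 m = DLmul (lamp1 m') (lamp1 (m - m')) by rewrite lamp1D addrC subrK.
  by apply: coset_eq => //; apply: Uk; split=> // i ik; rewrite /= E.
have -> : lamp2 m = DLmul (lamp2 m') (lamp2 (m - m')) by rewrite lamp2D addrC subrK.
by apply: coset_eq => //; apply: Uk; split=> // i ik; rewrite /= E.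
Qed.

(** The obstruction to trading the pair (m, 1) for (1, n); up to boundaries it is additive in (m,
    n). *)
Definition flip_chain m n : fsum p (DL p * DL p) :=
  csub (torus p (lamp1 m) (lamp2 1)) (torus p (lamp1 1) (lamp2 n)).

Lemma flip_chain_cycle m n : is_cycle2 (@DLmul p) (flip_chain m n).
Proof. by apply: torus_csub_cycle; apply: lampC. Qed.

Lemma flip_chainD m1 n1 m2 n2 : is_boundary2 (@DLmul p)
  (csub (flip_chain m1 n1 ++ flip_chain m2 n2) (flip_chain (m1 + m2) (n1 + n2))).
Proof.
have D1 := torusD p (lampC m1 1) (lampC m2 1); rewrite lamp1D in D1.
have D2 := torusD p (esym (lampC 1 n1)) (esym (lampC 1 n2)); rewrite lamp2D in D2.
apply: boundary_chain_eq (boundary_cat D1 D2) => k.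
by rewrite /flip_chain /torus /csub /= !coef_cons coef_nil /=; ring.
Qed.

Lemma flip_chain_boundaryD m1 n1 m2 n2 :
  is_boundary2 (@DLmul p) (flip_chain m1 n1) -> is_boundary2 (@DLmul p) (flip_chain m2 n2) ->
  is_boundary2 (@DLmul p) (flip_chain (m1 + m2) (n1 + n2)).
Proof.
move=> b1 b2; apply: boundary_chain_eq (boundary_csub (boundary_cat b1 b2) (flip_chainD m1 n1 m2 n2)).
by move=> k; rewrite coef_csub coef_cat coef_csub coef_cat; ring.
Qed.

Lemma flip_chain_boundaryB m1 n1 m2 n2 :
  is_boundary2 (@DLmul p) (flip_chain m1 n1) -> is_boundary2 (@DLmul p) (flip_chain m2 n2) ->
  is_boundary2 (@DLmul p) (flip_chain (m1 - m2) (n1 - n2)).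
Proof.
move=> b1 b2; have D := flip_chainD (m1 - m2) (n1 - n2) m2 n2; rewrite !subrK in D.
apply: boundary_chain_eq (boundary_csub (boundary_cat D b1) b2) => k.
by rewrite coef_csub coef_cat coef_csub coef_cat; ring.
Qed.

(** Conjugation by t^-a carries the pair (t^a, 1) to (1, t^-a). *)
Lemma flip_chain_T a : is_boundary2 (@DLmul p) (flip_chain (T a) (T (popp hp a))).
Proof.
apply: (@torus_conj _ _ _ (0, 0, popp hp a)); try exact: lampC.
  rewrite !DLmulE T0 // [padd (padic0 p) _]paddC !padd0 !mulr0 !addr0 !add0r.
  by rewrite mulrC TN.
rewrite !DLmulE T0 // [padd (padic0 p) _]paddC !padd0 !mulr0 !addr0 !add0r.
by rewrite mulr1.
Qed.

Lemma flip_chain0 : is_boundary2 (@DLmul p) (flip_chain 0 0).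
Proof.
by have b := flip_chain_T (padic0 p); have := flip_chain_boundaryB b b; rewrite !subrr.
Qed.

Variable beta : nat -> padic p.
Hypothesis vbeta : valuation_seq beta.

(** The cycle z_a, with [beta] in place of p^k. *)
Definition flip_class a : fsum p (DL p * DL p) :=
  flip_chain (T a * lim beta) (T (popp hp a) * lim (popp hp \o beta)).

(* Modulo an open subgroup both series become finite sums of group elements, and t^c (x) 1 = 1 (x) t^-c in the coinvariants. *)
Lemma flip_class_ker a : in_ker_phi (flip_class a).
Proof.
split; first exact: flip_chain_cycle.
move=> U oU; have [k Ek] := coset_lamp oU.
pose F b (be : nat -> padic p) := T b * \sum_(i < k) (T (be i) - 1).
have agF b be : valuation_seq be -> agree k (T b * lim be) (F b be).
  by move=> vbe; apply: agreeM => //; apply: lim_agree.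
have [E1 _] := Ek _ _ (agF a beta vbeta).
have [_ E2] := Ek _ _ (agF (popp hp a) _ (valuation_popp hp vbeta)).
have [w Hw] : quot_trivial U (flip_chain (F a beta) (F (popp hp a) (popp hp \o beta))).
  apply: boundary_quot_trivial => //; rewrite /F.
  elim: k {Ek F agF E1 E2} => [|k IH]; first by rewrite !big_ord0 !mulr0; apply: flip_chain0.
  rewrite !big_ord_recr /= (mulrDr (T a)) (mulrDr (T (popp hp a))); apply: flip_chain_boundaryD IH _.
  rewrite !mulrBr !mulr1 -!T_padd // -poppD.
  by apply: flip_chain_boundaryB; apply: flip_chain_T.
by exists w => x; rewrite -Hw /flip_class /flip_chain /push /= E1 E2.
Qed.

(** Taking the j-th coefficient gives values in F_p, as [pairing] requires. *)
Definition cocycle (L : pseries p -> pseries p) j (x : DL p * DL p) : 'F_p :=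
  (x.1.1.1 * T (popp hp x.1.2) * L x.2.1.2) j.

(* Given a 3-chain w, a semilinear L defined on the finitely many series occurring in w makes (g, h) |-> g_1 t^-g L(h_2) a cocycle on w. *)
Lemma flip_class_independent a b (z : fsum p (DL p * DL p)) :
  is_boundary2 (@DLmul p) (csub (flip_class a) z) ->
  is_boundary2 (@DLmul p) (csub (flip_class b) z) -> a = b.
Proof.
move=> ba bb; have [w ew] := boundary_csub ba bb.
pose snd2 (x : DL p) : pseries p := x.1.2.
pose s := flatten [seq [:: snd2 x.1.1.2; snd2 x.1.2] | x : DL p * DL p * DL p * 'F_p <- w].
(* The sequence is negated because [L] is applied to the second lamp, where f' occurs. *)
have [N [L [NL Ns]]] := separating_exists hp (valuation_popp hp vbeta) s.
have [SL N1 Nl L1 Ll] := NL; have [N0 L0] := semilinear_zero SL N1; have [ND NT] := SL.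
have vanish j : pairing (cocycle L j) (d3 (@DLmul p) w) = 0.
  rewrite pairing_d3 big1_seq // => -[[[g h] k] c] /= xw.
  have sw (v : pseries p) : v \in [:: snd2 h; snd2 k] -> N v.
    by move=> vs; apply: Ns; apply/flatten_mapP; exists (g, h, k, c).
  case: g h k sw {xw} => [[m1 n1] a1] [[m2 n2] a2] [[m3 n3] a3] /= sw.
  have N2 : N n2 by apply: sw; rewrite inE eqxx.
  have N3 : N n3 by apply: sw; rewrite !inE eqxx orbT.
  rewrite /cocycle !DLmulE /=; have [NTn LTn] := NT a2 _ N3; rewrite (ND _ _ N2 NTn).2 LTn.
  rewrite poppD T_padd // -!oppsE -!addsE.
  set t := T a1; set t' := T (popp hp a1); set u := T (popp hp a2).
  (* The cocycle defect is a multiple of 1 - t^a1 t^-a1 = 0. *)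
  rewrite (_ : _ + _ = (1 - t * t') * (m2 * u * L n3)); last by ring.
  by rewrite /t /t' TN subrr mul0r mulr0.
have value j c : pairing (cocycle L j) (flip_class c) = (- (T c * L (lim (popp hp \o beta)))) j.
  (* Only the pair formed by [lamp1 1] and the second series survives: L 1 = 0 kills the other
     torus, and L 0 = 0 the reversed pairs. *)
  rewrite /flip_class pairing_csub /pairing !big_cons !big_nil /cocycle /= L1 L0 !mulr0 popp0.
  have [_ ->] := NT (popp hp c) _ Nl; rewrite poppK T0 //.
  by rewrite !addr0 add0r !mul1r.
have e : (T a - T b) * L (lim (popp hp \o beta)) = 0.
  apply: funext => j; have := vanish j; rewrite -(pairing_chain_eq _ ew).
  rewrite pairing_csub (pairing_csub _ (flip_class a)) (pairing_csub _ (flip_class b)) !value zeros mulrBl !(addsE, oppsE) => h.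
  by apply: oppr_inj; rewrite oppr0 -h; ring.
case: (muls_eq0 e) => // /eqP; rewrite subr_eq0 => /eqP Tab.
(* Injectivity of [T]: the indicator of the class of [a] modulo p^n tells the Dirac masses apart. *)
apply: padicP => n; apply/eqP; apply: contrapT => nab.
have := @measure_T p hp n (fun j => (j == res n a)%:R) a.
rewrite Tab measure_T // eqxx eq_sym; case: eqP => [ab|_]; first by case: nab; apply/eqP.
by move/eqP; rewrite eq_sym oner_eq0.
Qed.

End Lamplighter.

(* ker phi is uncountable: no sequence of 2-chains meets every class of ker phi *)
Theorem theorem4p3 (p : nat) (hp : prime p) :
  ~ (exists s : nat -> fsum p (DL p * DL p),
       forall z : fsum p (DL p * DL p), in_ker_phi z ->
         exists n : nat, is_boundary2 (@DLmul p) (csub z (s n))).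
Proof.
move=> [s hs]; pose homologous a n :=
  is_boundary2 (@DLmul p) (csub (flip_class hp (@ppow p) a) (s n)).
(* Each [s n] is homologous to at most one z_a, whose index [epsilon] selects; the diagonal argument
   supplies an [a] outside this list. *)
have [a ha] := padic_uncountable hp (fun n => epsilon (inhabits (padic0 p)) (homologous^~ n)).
have vp := valuation_ppow hp.
have [n bn] := hs _ (flip_class_ker hp vp a).
apply: (ha n); apply: (flip_class_independent vp bn).
by apply: (epsilon_spec _ (homologous^~ n)); exists a.
Qed.
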